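(* Let $X$ be a Banach space and let $T\in L(X)$. If $T$ is hypercyclic on $X$, then $B_T$ is hypercyclic on $\ell^p(X,\mathbb{N})$ (for every $1\le p<\infty$) and on $c_0(X,\mathbb{N})$.
   Context: $\mathbb{N}=\{1,2,3,\dots\}$; $L(X)$ denotes the bounded linear operators on $X$. $\ell^p(X,\mathbb{N})$ is the Banach space of sequences $(x_k)_{k\in\mathbb{N}}$ in $X$ with $\sum_k\|x_k\|^p<\infty$ (with the $\ell^p$-norm), and $c_0(X,\mathbb{N})$ is the Banach space of sequences in $X$ with $\|x_k\|\to 0$ (with the sup norm). $B_T$ is the bounded operator $B_T(x_k)_{k\in\mathbb{N}}=(Tx_{k+1})_{k\in\mathbb{N}}$. An operator $S$ on a Banach space $Y$ is hypercyclic if some $y\in Y$ has dense orbit $\{S^ny:n\ge 0\}$. *)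

(* Defs.v *)
From HB Require Import structures.
From mathcomp Require Import all_boot all_order all_algebra.
From mathcomp Require Import complex.
From mathcomp Require Import all_classical all_reals all_analysis.

Set Implicit Arguments.
Unset Strict Implicit.
Unset Printing Implicit Defensive.

Import Order.TTheory GRing.Theory Num.Theory.
Import numFieldNormedType.Exports.
Local Open Scope classical_set_scope.
Local Open Scope ring_scope.

(* A Banach space is over R or over C: it is a
   completeNormedModType (scalars R k) for either value of k. *)
Variant scalar_kind := RealScalars | ComplexScalars.

Definition scalars (R : realType) (k : scalar_kind) : numFieldType :=
  match k with RealScalars => R | ComplexScalars => R[i] end.

Definition of_real (R : realType) (k : scalar_kind) : R -> scalars R k :=
  match k with RealScalars => fun a => a | ComplexScalars => fun a => a%:C%C end.

Definition real_part (R : realType) (k : scalar_kind) : scalars R k -> R :=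
  match k with RealScalars => fun a => a | ComplexScalars => fun a => complex.Re a end.
Arguments of_real {R} k a.
Arguments real_part {R k} a.

Section ScalarsTheory.
Context {R : realType} {k : scalar_kind}.
Local Notation K := (scalars R k).
Implicit Types (a b : R) (x y : K).

Lemma of_realK a : real_part (of_real k a) = a.
Proof. by case: k. Qed.

Lemma real_partK x : x \is Num.real -> of_real k (real_part x) = x.
Proof. by case: k x => //= x; exact: RRe_real. Qed.

Lemma of_realD a b : of_real k (a + b) = of_real k a + of_real k b.
Proof. by case: k => //=; exact: rmorphD. Qed.

Lemma of_realM a b : of_real k (a * b) = of_real k a * of_real k b.
Proof. by case: k => //=; exact: rmorphM. Qed.

Lemma of_real0 : of_real k (0 : R) = 0.
Proof. by case: k. Qed.

Lemma of_real_le a b : (of_real k a <= of_real k b) = (a <= b).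
Proof. by case: k => //=; rewrite lecR. Qed.

Lemma of_real_lt a b : (of_real k a < of_real k b) = (a < b).
Proof. by case: k => //=; rewrite ltcR. Qed.

End ScalarsTheory.

(* In a normedModType K the norm is valued in K, hence in R[i] for complex
   spaces; rnorm is the same number as an element of R. *)
Definition rnorm (R : realType) (k : scalar_kind) (X : normedModType (scalars R k))
  (x : X) : R := real_part `|x|.

Arguments rnorm {R k X} x.

Section RnormTheory.
Context {R : realType} {k : scalar_kind} {X : normedModType (scalars R k)}.
Implicit Types x y : X.

Lemma rnormE x : `|x| = of_real k (rnorm x).
Proof. by rewrite real_partK// normr_real. Qed.

Lemma rnorm_ge0 x : 0 <= rnorm x.
Proof. by rewrite -(of_real_le (k := k)) -rnormE of_real0. Qed.

Lemma rnormD x y : rnorm (x + y) <= rnorm x + rnorm y.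
Proof. by rewrite -(of_real_le (k := k)) of_realD -!rnormE ler_normD. Qed.

Lemma rnormZ (l : scalars R k) x : rnorm (l *: x) = real_part `|l| * rnorm x.
Proof.
apply: (can_inj (of_realK (k := k))).
by rewrite of_realM -!rnormE normrZ real_partK// normr_real.
Qed.

Lemma rnorm0 : rnorm (0 : X) = 0.
Proof. by rewrite /rnorm normr0 -(of_real0 (k := k)) of_realK. Qed.

Lemma rnorm0_eq0 x : rnorm x = 0 -> x = 0.
Proof. by move=> x0; apply/eqP; rewrite -normr_eq0 rnormE x0 of_real0. Qed.

Lemma rnormN x : rnorm (- x) = rnorm x.
Proof. by rewrite /rnorm normrN. Qed.

End RnormTheory.

Section RnormTopology.
Context {R : realType} {k : scalar_kind} {X : normedModType (scalars R k)}.

Lemma of_real_gt0 (e : R) : 0 < e -> 0 < of_real k e.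
Proof. by move=> e0; rewrite -of_real0 of_real_lt. Qed.

Lemma real_part_gt0 (e : scalars R k) :
  0 < e -> 0 < real_part e /\ e = of_real k (real_part e).
Proof.
move=> e0; have eE : e = of_real k (real_part e) by rewrite real_partK// gtr0_real.
by split=> //; move: e0; rewrite {1}eE -{1}(of_real0 (k := k)) of_real_lt.
Qed.

Lemma cvg_rnormP (T : Type) (F : set_system T) (FF : Filter F) (f : T -> X)
    (l : X) :
  f @ F --> l <-> forall e : R, 0 < e -> \forall t \near F, rnorm (l - f t) < e.
Proof.
split=> [/cvgrPdist_lt fl e e0|fl].
  have := fl _ (of_real_gt0 e0); apply: filterS => t.
  by rewrite rnormE of_real_lt.
apply/cvgrPdist_lt => e /real_part_gt0[e0 ->].
by have := fl _ e0; apply: filterS => t; rewrite rnormE of_real_lt.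
Qed.

Lemma cauchy_rnormP (F : set_system X) (FF : Filter F) :
  cauchy F <->
  forall e : R, 0 < e -> \forall x & y \near F, rnorm (x - y) < e.
Proof.
rewrite -cauchy_ballP; split=> [Fc e e0|Fc e /real_part_gt0[e0 ->]].
  have := Fc _ (of_real_gt0 e0); apply: filterS => t.
  by rewrite -ball_normE /ball_/= rnormE of_real_lt.
have := Fc _ e0; apply: filterS => t.
by rewrite -ball_normE /ball_/= rnormE of_real_lt.
Qed.

End RnormTopology.

(* For a linear map, boundedness near 0 is boundedness (linear_boundedP). *)
Record bounded_operator (K : numFieldType) (X : normedModType K) :=
  BoundedOperator {
    bounded_operator_linear :> {linear X -> X} ;
    bounded_operatorP : bounded_near bounded_operator_linear (nbhs (0 : X)) }.

Section BoundedOperatorTheory.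
Context {R : realType} {k : scalar_kind} {X : normedModType (scalars R k)}.

Lemma bounded_operator_rnorm (T : bounded_operator X) :
  exists2 M : R, 0 < M & forall x, rnorm (T x) <= M * rnorm x.
Proof.
have /linear_boundedP/pinfty_ex_gt0[M /real_part_gt0[M0 ->] TM] :=
  bounded_operatorP T.
exists (real_part M) => // x.
by rewrite -(of_real_le (k := k)) of_realM -!rnormE.
Qed.

Lemma rnorm_bounded_near (f : {linear X -> X}) (M : R) : 0 <= M ->
  (forall x, rnorm (f x) <= M * rnorm x) -> bounded_near f (nbhs (0 : X)).
Proof.
move=> M0 fM; apply/linear_boundedP.
have MR : of_real k M \is Num.real by rewrite ger0_real// -of_real0 of_real_le.
near=> r => x.
rewrite (@le_trans _ _ (of_real k M * `|x|))//.
  by rewrite !rnormE -of_realM of_real_le.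
by rewrite ler_wpM2r//; near: r; exact: nbhs_pinfty_ge.
Unshelve. all: by end_near. Qed.

End BoundedOperatorTheory.

Definition hypercyclic (K : numFieldType) (Y : completeNormedModType K)
    (S : bounded_operator Y) :=
  exists y : Y, dense (range (fun n => iter n S y)).

Section LpSequences.
Context {R : realType} {k : scalar_kind} {X : normedModType (scalars R k)} (p : R).
Implicit Types x y : nat -> X.

Definition lp_sum x : \bar R := (\sum_(n <oo) (rnorm (x n) `^ p)%:E)%E.

Definition lp_norm x : R := fine (lp_sum x) `^ p^-1.

(* The proof of 1 <= p is a parameter so that the submodule structure below,
   which depends on it, is found by inference. *)
Definition lp_seq of 1 <= p : {pred nat -> X} :=
  [pred x | `[< (lp_sum x < +oo)%E >]].

Hypothesis p1 : 1 <= p.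

Let p_gt0 : 0 < p. Proof. exact: lt_le_trans p1. Qed.

Lemma lp_seqP x : reflect (lp_sum x < +oo)%E (x \in lp_seq p1).
Proof. exact: asboolP. Qed.

Lemma lp_sum_ge0 x : (0 <= lp_sum x)%E.
Proof. by apply: nneseries_ge0 => n _ _; rewrite lee_fin powR_ge0. Qed.

Lemma lp_sum_fin x : x \in lp_seq p1 -> lp_sum x \is a fin_num.
Proof. by move=> /lp_seqP xoo; rewrite ge0_fin_numE// lp_sum_ge0. Qed.

Lemma lp_sum_partial x n : (\sum_(0 <= i < n) (rnorm (x i) `^ p)%:E <= lp_sum x)%E.
Proof. by apply: nneseries_lim_ge => i _ _; rewrite lee_fin powR_ge0. Qed.

Lemma lp_sum_le x (c : \bar R) :
  (forall n, \sum_(0 <= i < n) (rnorm (x i) `^ p)%:E <= c)%E -> (lp_sum x <= c)%E.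
Proof.
move=> xc; apply: lime_le; last exact: nearW.
by apply: is_cvg_nneseries => n _ _; rewrite lee_fin powR_ge0.
Qed.

Lemma lp_norm_ge0 x : 0 <= lp_norm x.
Proof. exact: powR_ge0. Qed.

Lemma lp_normE x : x \in lp_seq p1 -> (lp_norm x)%:E = poweR (lp_sum x) p^-1.
Proof.
by move=> /lp_sum_fin xfin; rewrite /lp_norm -poweR_EFin fineK.
Qed.

Lemma lp_norm_leP x c : 0 <= c ->
  (x \in lp_seq p1) && (lp_norm x <= c) = (lp_sum x <= (c `^ p)%:E)%E.
Proof.
move=> c0; apply/idP/idP => [/andP[xp xc]|xc].
  rewrite -(fineK (lp_sum_fin xp)) lee_fin.
  have -> : fine (lp_sum x) = lp_norm x `^ p.
    by rewrite /lp_norm -powRrM mulVf ?gt_eqF// powRr1// fine_ge0// lp_sum_ge0.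
  by apply: ge0_ler_powR => //; rewrite ?nnegrE ?lp_norm_ge0// ltW.
have xp : x \in lp_seq p1 by apply/lp_seqP; rewrite (le_lt_trans xc) ?ltry.
rewrite xp /=; have -> : c = (c `^ p) `^ p^-1.
  by rewrite -powRrM mulfV ?gt_eqF// powRr1.
apply: ge0_ler_powR; rewrite ?nnegrE ?invr_ge0 ?powR_ge0//.
- exact: ltW.
- by rewrite fine_ge0// lp_sum_ge0.
- by rewrite -lee_fin fineK// lp_sum_fin.
Qed.

Lemma le_rnorm_lp_norm x n : x \in lp_seq p1 -> rnorm (x n) <= lp_norm x.
Proof.
move=> xp; rewrite -[leLHS](@powRr1) ?rnorm_ge0//.
rewrite -(mulfV (lt0r_neq0 p_gt0)) powRrM.
apply: ge0_ler_powR; rewrite ?nnegrE ?invr_ge0 ?powR_ge0//.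
- exact: ltW.
- by rewrite fine_ge0// lp_sum_ge0.
rewrite -lee_fin fineK ?lp_sum_fin//.
apply: le_trans (lp_sum_partial x n.+1).
rewrite big_nat_recr//= leeDr//.
by apply: sume_ge0 => i _; rewrite lee_fin powR_ge0.
Qed.

Lemma poweR_lp_sum x :
  poweR (lp_sum x) p^-1 = 'N[counting]_p%:E [EFin \o (rnorm \o x)]%E.
Proof.
rewrite Lnorm_counting//; congr (poweR _ _).
by apply: eq_eseriesr => n _; rewrite /= ger0_norm ?rnorm_ge0.
Qed.

Lemma lp_sum_minkowski x y :
  (poweR (lp_sum (x + y)%R) p^-1 <=
   poweR (lp_sum x) p^-1 + poweR (lp_sum y) p^-1)%E.
Proof.
rewrite !poweR_lp_sum.
apply: (@le_trans _ _ ('N[counting]_p%:E [EFin \o ((rnorm \o x) \+ (rnorm \o y))%R])%E).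
  rewrite !Lnorm_counting//.
  apply: gt0_ler_poweR; rewrite ?invr_ge0 ?(ltW p_gt0)//.
  - by rewrite in_itv/= leey andbT nneseries_ge0// => n _ _; rewrite poweR_ge0.
  - by rewrite in_itv/= leey andbT nneseries_ge0// => n _ _; rewrite poweR_ge0.
  apply: lee_nneseries => [n _ _|n _]; first by rewrite poweR_ge0.
  rewrite !poweR_EFin lee_fin ge0_ler_powR ?nnegrE ?(ltW p_gt0)//.
  rewrite /= !ger0_norm ?addr_ge0 ?rnorm_ge0//.
  exact: rnormD.
by apply: minkowski_EFin.
Qed.

Lemma lp_seqD x y : x \in lp_seq p1 -> y \in lp_seq p1 -> x + y \in lp_seq p1.
Proof.
move=> xp yp; apply/lp_seqP; apply: (@lty_poweRy _ _ p^-1).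
  by rewrite invr_neq0// gt_eqF.
apply: le_lt_trans (lp_sum_minkowski x y) _.
by rewrite -!lp_normE// -EFinD ltry.
Qed.

Lemma lp_normD x y : x \in lp_seq p1 -> y \in lp_seq p1 ->
  lp_norm (x + y) <= lp_norm x + lp_norm y.
Proof.
move=> xp yp; have := lp_sum_minkowski x y.
by rewrite -(lp_normE xp) -(lp_normE yp) -(lp_normE (lp_seqD xp yp)).
Qed.

Lemma lp_sumZ (l : scalars R k) x :
  lp_sum (l *: x) = ((real_part `|l| `^ p)%:E * lp_sum x)%E.
Proof.
have l0 : 0 <= real_part `|l|.
  by rewrite -(of_real_le (k := k)) of_real0 real_partK ?normr_real.
rewrite -nneseriesZl => [|n _]; last by rewrite lee_fin powR_ge0.
apply: eq_eseriesr => n _; rewrite -EFinM; congr (_%:E).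
by rewrite -powRM ?rnorm_ge0// -rnormZ.
Qed.

Lemma lp_seqZ (l : scalars R k) x : x \in lp_seq p1 -> l *: x \in lp_seq p1.
Proof.
by move=> xp; apply/lp_seqP; rewrite lp_sumZ -(fineK (lp_sum_fin xp)) -EFinM ltry.
Qed.

Lemma lp_normZ (l : scalars R k) x : x \in lp_seq p1 ->
  lp_norm (l *: x) = real_part `|l| * lp_norm x.
Proof.
have l0 : 0 <= real_part `|l|.
  by rewrite -(of_real_le (k := k)) of_real0 real_partK ?normr_real.
move=> xp; rewrite /lp_norm lp_sumZ -(fineK (lp_sum_fin xp)) -EFinM/=.
rewrite powRM ?powR_ge0 ?fine_ge0 ?lp_sum_ge0//.
by rewrite -powRrM mulfV ?gt_eqF// powRr1.
Qed.

Lemma lp_sum0 : lp_sum 0 = 0%E.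
Proof. by apply: eseries0 => n _ _; rewrite rnorm0 powR0// gt_eqF. Qed.

Lemma lp_norm0_eq0 x : x \in lp_seq p1 -> lp_norm x = 0 -> x = 0.
Proof.
move=> xp x0; apply/funext => n; apply: rnorm0_eq0; apply/le_anti.
by rewrite rnorm_ge0 andbT -x0 le_rnorm_lp_norm.
Qed.

Lemma lp_seq_submod_closed : submod_closed (lp_seq p1).
Proof.
split=> [|l x y xp yp]; first by apply/lp_seqP; rewrite lp_sum0 ltry.
by rewrite lp_seqD// lp_seqZ.
Qed.

End LpSequences.

HB.instance Definition _ R k (X : normedModType (scalars R k)) (p : R)
    (p1 : 1 <= p) :=
  GRing.isSubmodClosed.Build _ _ (@lp_seq R k X p p1)
    (lp_seq_submod_closed p1).

Record ellp (R : realType) (k : scalar_kind) (X : normedModType (scalars R k))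
    (p : R) (p1 : 1 <= p) :=
  Ellp { ellp_seq :> nat -> X ; ellpP : ellp_seq \in lp_seq p1 }.
Arguments ellp {R k} X {p} p1.

Section EllpNormed.
Context {R : realType} {k : scalar_kind} {X : normedModType (scalars R k)} {p : R}.
Variable p1 : 1 <= p.

HB.instance Definition _ := [isSub for @ellp_seq R k X p p1].
HB.instance Definition _ := [Choice of ellp X p1 by <:].
HB.instance Definition _ := [SubChoice_isSubLmodule of ellp X p1 by <:].

Let norm (x : ellp X p1) : scalars R k := of_real k (lp_norm p x).

Let ler_normD x y : norm (x + y) <= norm x + norm y.
Proof. by rewrite -of_realD of_real_le lp_normD ?ellpP. Qed.

Let normrZ l x : norm (l *: x) = `|l| * norm x.
Proof.
by rewrite /norm (lp_normZ l (ellpP x)) of_realM real_partK// normr_real.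
Qed.

Let normr0_eq0 x : norm x = 0 -> x = 0.
Proof.
rewrite /norm -(of_real0 (k := k)) => /(can_inj of_realK)/(lp_norm0_eq0 (ellpP x)).
by move=> x0; exact/val_inj.
Qed.

HB.instance Definition _ :=
  Lmodule_isNormed.Build (scalars R k) (ellp X p1) ler_normD normrZ normr0_eq0.

Lemma ellp_rnormE (x : ellp X p1) : rnorm x = lp_norm p x.
Proof. exact: of_realK. Qed.

End EllpNormed.

Section C0Sequences.
Context {R : realType} {k : scalar_kind} {X : normedModType (scalars R k)}.
Implicit Types x y : nat -> X.

Definition c0_seq : {pred nat -> X} :=
  [pred x | `[< (fun n => rnorm (x n)) @ \oo --> (0 : R) >]].

Definition sup_norm x : R := sup (range (fun n => rnorm (x n))).

Lemma c0_seqP x :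
  reflect ((fun n => rnorm (x n)) @ \oo --> (0 : R)) (x \in c0_seq).
Proof. exact: asboolP. Qed.

Lemma c0_seq_has_ubound x : x \in c0_seq -> has_ubound (range (fun n => rnorm (x n))).
Proof.
by move=> /c0_seqP x0; case: (cvg_has_sup (cvgP _ x0)).
Qed.

Lemma le_rnorm_sup_norm x n : x \in c0_seq -> rnorm (x n) <= sup_norm x.
Proof. by move=> /c0_seq_has_ubound/ub_le_sup; apply; exists n. Qed.

Lemma sup_norm_le x c : (forall n, rnorm (x n) <= c) -> sup_norm x <= c.
Proof.
move=> xc; apply: ge_sup; first by exists (rnorm (x 0%N)), 0%N.
by move=> _ [n _ <-].
Qed.

Lemma c0_seqD x y : x \in c0_seq -> y \in c0_seq -> x + y \in c0_seq.
Proof.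
move=> /c0_seqP x0 /c0_seqP y0; apply/c0_seqP.
have xy0 := cvgD x0 y0; rewrite addr0 in xy0.
apply: (squeeze_cvgr (f := cst 0) (h := fun n => rnorm (x n) + rnorm (y n))).
- by apply: nearW => n; rewrite rnorm_ge0; exact: rnormD.
- exact: cvg_cst.
- exact: xy0.
Qed.

Lemma c0_seqZ (l : scalars R k) x : x \in c0_seq -> l *: x \in c0_seq.
Proof.
move=> /c0_seqP x0; apply/c0_seqP.
under eq_fun do rewrite rnormZ.
by rewrite -(mulr0 (real_part `|l|)); apply: cvgMl_tmp.
Qed.

Lemma sup_normD x y : x \in c0_seq -> y \in c0_seq ->
  sup_norm (x + y) <= sup_norm x + sup_norm y.
Proof.
move=> x0 y0; apply: sup_norm_le => n.
by apply: le_trans (rnormD _ _) _; rewrite lerD// le_rnorm_sup_norm.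
Qed.

Lemma sup_norm0_eq0 x : x \in c0_seq -> sup_norm x = 0 -> x = 0.
Proof.
move=> xc x0; apply/funext => n; apply: rnorm0_eq0; apply/le_anti.
by rewrite rnorm_ge0 andbT -x0 le_rnorm_sup_norm.
Qed.

Lemma sup_normZ (l : scalars R k) x : x \in c0_seq ->
  sup_norm (l *: x) = real_part `|l| * sup_norm x.
Proof.
have l0 : 0 <= real_part `|l|.
  by rewrite -(of_real_le (k := k)) of_real0 real_partK ?normr_real.
move=> xc; apply/le_anti/andP; split.
  by apply: sup_norm_le => n; rewrite rnormZ ler_wpM2l// le_rnorm_sup_norm.
have /orP[/eqP {}l0|{}l0] : (0 == real_part `|l|) || (0 < real_part `|l|).
    by rewrite -le_eqVlt.
  rewrite -l0 mul0r; apply: le_trans (le_rnorm_sup_norm 0 (c0_seqZ l xc)).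
  exact: rnorm_ge0.
rewrite -ler_pdivlMl//; apply: sup_norm_le => n.
by rewrite ler_pdivlMl// -rnormZ (le_rnorm_sup_norm n (c0_seqZ l xc)).
Qed.

Lemma c0_seq_submod_closed : submod_closed c0_seq.
Proof.
split=> [|l x y xp yp]; last by rewrite c0_seqD// c0_seqZ.
by apply/c0_seqP; under eq_fun do rewrite rnorm0; exact: cvg_cst.
Qed.

End C0Sequences.

HB.instance Definition _ R k (X : normedModType (scalars R k)) :=
  GRing.isSubmodClosed.Build _ _ (@c0_seq R k X) c0_seq_submod_closed.

Record c0 (R : realType) (k : scalar_kind) (X : normedModType (scalars R k)) :=
  C0 { c0_val :> nat -> X ; c0P : c0_val \in c0_seq }.
Arguments c0 {R k} X.

Section C0Normed.
Context {R : realType} {k : scalar_kind} {X : normedModType (scalars R k)}.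

HB.instance Definition _ := [isSub for @c0_val R k X].
HB.instance Definition _ := [Choice of c0 X by <:].
HB.instance Definition _ := [SubChoice_isSubLmodule of c0 X by <:].

Let norm (x : c0 X) : scalars R k := of_real k (sup_norm x).

Let ler_normD x y : norm (x + y) <= norm x + norm y.
Proof. by rewrite -of_realD of_real_le sup_normD ?c0P. Qed.

Let normrZ l x : norm (l *: x) = `|l| * norm x.
Proof.
by rewrite /norm (sup_normZ l (c0P x)) of_realM real_partK// normr_real.
Qed.

Let normr0_eq0 x : norm x = 0 -> x = 0.
Proof.
rewrite /norm -(of_real0 (k := k)) => /(can_inj of_realK)/(sup_norm0_eq0 (c0P x)).
by move=> x0; exact/val_inj.
Qed.

HB.instance Definition _ :=
  Lmodule_isNormed.Build (scalars R k) (c0 X) ler_normD normrZ normr0_eq0.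

Lemma c0_rnormE (x : c0 X) : rnorm x = sup_norm x.
Proof. exact: of_realK. Qed.

End C0Normed.

Section C0Complete.
Context {R : realType} {k : scalar_kind} {X : completeNormedModType (scalars R k)}.

Lemma cauchy_coord (V : normedModType (scalars R k)) (f : V -> X)
    (F : set_system V) :
  ProperFilter F -> (forall x y, rnorm (f x - f y) <= rnorm (x - y)) ->
  cauchy F -> cvg (f @ F).
Proof.
move=> FF ff /cauchy_rnormP Fc; apply: cauchy_cvg; apply/cauchy_rnormP => e e0.
rewrite near_map2; apply: filterS (Fc _ e0) => -[x y] /=.
exact: le_lt_trans.
Qed.

Lemma c0_complete (F : set_system (c0 X)) : ProperFilter F -> cauchy F -> cvg F.
Proof.
move=> FF Fc.
have coordB (n : nat) (x y : c0 X) : rnorm (x n - y n) <= rnorm (x - y).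
  by rewrite c0_rnormE; exact: (le_rnorm_sup_norm n (c0P (x - y))).
have coord n : cvg ((fun x : c0 X => x n) @ F).
  by apply: cauchy_coord => //; exact: coordB.
pose z n := lim ((fun x : c0 X => x n) @ F).
have zE (e : R) : 0 < e -> \forall x \near F,
    forall n, rnorm ((x : c0 X) n - z n) <= e.
  move=> e0; have /cauchy_rnormP/(_ _ e0)/nearP_dep := Fc.
  apply: filterS => x xF n; apply/ler_addgt0Pr => d d0.
  have /cvg_rnormP/(_ _ d0) := coord n => zd.
  near F => y.
  rewrite -(subrKA (y n)) (le_trans (rnormD _ _))// lerD//.
    by rewrite (le_trans (coordB _ _ _))// ltW//; near: y.
  by rewrite -rnormN opprB ltW//; near: y.
have zc : z \in c0_seq.
  apply/c0_seqP/cvgrPdist_le => e e0.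
  have e20 : 0 < e / 2 by rewrite divr_gt0.
  near F => x.
  have xe : forall n, rnorm (x n - z n) <= e / 2 by near: x; exact: zE.
  have /c0_seqP/cvgrPdist_le/(_ _ e20) := c0P x.
  apply: filterS => n; rewrite !sub0r !normrN !ger0_norm ?rnorm_ge0// => xn.
  have -> : z n = x n - (x n - z n) by rewrite opprB addrCA subrr addr0.
  by rewrite (le_trans (rnormD _ _))// rnormN (splitr e) lerD.
apply/cvg_ex; exists (C0 zc); apply/cvg_rnormP => e e0.
have e20 : 0 < e / 2 by rewrite divr_gt0.
apply: filterS (zE _ e20) => x xe.
rewrite -rnormN opprB c0_rnormE; apply: (@le_lt_trans _ _ (e / 2)).
  by apply: sup_norm_le => n; exact: xe.
by rewrite ltr_pdivrMr// ltr_pMr// ltr1n.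
Unshelve. all: by end_near. Qed.

HB.instance Definition _ := Uniform_isComplete.Build (c0 X) c0_complete.

End C0Complete.

Section EllpComplete.
Context {R : realType} {k : scalar_kind} {X : completeNormedModType (scalars R k)}.
Context {p : R}.
Variable p1 : 1 <= p.

Lemma powR_cvg (T : Type) (F : set_system T) (FF : Filter F) (f : T -> R) (a : R) :
  0 <= a -> (forall t, 0 <= f t) -> f @ F --> a ->
  (fun t => f t `^ p) @ F --> a `^ p.
Proof.
have p0 : 0 < p by exact: lt_le_trans p1.
rewrite le_eqVlt => /predU1P[<-|a0] f0 fa.
  rewrite powR0 ?gt_eqF//.
  suff sq : \forall t \near F, cst 0 t <= f t `^ p <= f t.
    by apply: (squeeze_cvgr sq) => //; exact: cvg_cst.
  have : \forall t \near F, f t <= 1.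
    have /cvgrPdist_le/(_ _ ltr01) := fa; apply: filterS => t.
    by rewrite sub0r normrN ger0_norm.
  apply: filterS => t ft1; rewrite powR_ge0 /=.
  have [->|ft0] := eqVneq (f t) 0; first by rewrite powR0 ?gt_eqF.
  by rewrite ge1r_powR// lt_neqAle eq_sym ft0 f0.
apply: (@continuous_cvg _ _ _ _ _ _ (fun t => t `^ p)) => //.
apply/differentiable_continuous/derivable1_diffP/derivable_powR.
by rewrite in_itv/= a0.
Qed.

Lemma ellp_complete (F : set_system (ellp X p1)) :
  ProperFilter F -> cauchy F -> cvg F.
Proof.
move=> FF Fc.
have coordB (n : nat) (x y : ellp X p1) : rnorm (x n - y n) <= rnorm (x - y).
  by rewrite ellp_rnormE; exact: (le_rnorm_lp_norm n (ellpP (x - y))).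
have coord n : cvg ((fun x : ellp X p1 => x n) @ F).
  by apply: cauchy_coord => //; exact: coordB.
pose z n := lim ((fun x : ellp X p1 => x n) @ F).
have zE (e : R) : 0 < e -> \forall x \near F,
    (((x : ellp X p1) : nat -> X) - z \in lp_seq p1) && (lp_norm p ((x : nat -> X) - z) <= e).
  move=> e0; have /cauchy_rnormP/(_ _ e0)/nearP_dep := Fc.
  apply: filterS => x xF; rewrite (lp_norm_leP p1 _ (ltW e0)).
  apply: lp_sum_le => n.
  rewrite sumEFin lee_fin.
  have xyz : \sum_(0 <= i < n) rnorm (x i - y i) `^ p @[y --> F] -->
      \sum_(0 <= i < n) rnorm ((x : nat -> X) i - z i) `^ p.
    elim: n => [|n IHn].
      by under eq_fun do rewrite big_geq//; rewrite big_geq//; exact: cvg_cst.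
    under eq_fun do rewrite big_nat_recr//=; rewrite big_nat_recr//=.
    apply: cvgD => //; move: n {IHn} => i; apply: powR_cvg => [||] //.
    - exact: rnorm_ge0.
    - by move=> y; exact: rnorm_ge0.
    apply/cvgrPdist_lt => d d0.
    have /cvg_rnormP/(_ _ d0) := coord i; apply: filterS => y.
    apply: le_lt_trans; rewrite ler_norml; apply/andP; split.
      rewrite lerNl opprB lerBlDr.
      have -> : x i - y i = (z i - y i) + (x i - z i) by rewrite [RHS]addrC subrKA.
      exact: rnormD.
    rewrite lerBlDr -rnormN opprB.
    have -> : z i - x i = (z i - y i) - (x i - y i) by rewrite opprB subrKA.
    by rewrite (le_trans (rnormD _ _))// rnormN.
  apply: (cvgr_to_le xyz); apply: filterS xF => y xy.
  rewrite -lee_fin -sumEFin.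
  have := lp_sum_partial p ((x - y : ellp X p1) : nat -> X) n.
  move=> /le_trans; apply; rewrite -(lp_norm_leP p1 _ (ltW e0)).
  by rewrite ellpP -ellp_rnormE ltW.
have zp : z \in lp_seq p1.
  near F => x.
  have /andP[xz _] : ((x : nat -> X) - z \in lp_seq p1) &&
    (lp_norm p ((x : nat -> X) - z) <= 1) by near: x; exact: zE.
  have -> : z = (x : nat -> X) - ((x : nat -> X) - z).
    by rewrite opprB addrCA subrr addr0.
  by rewrite rpredB ?ellpP.
apply/cvg_ex; exists (Ellp zp); apply/cvg_rnormP => e e0.
have e20 : 0 < e / 2 by rewrite divr_gt0.
apply: filterS (zE _ e20) => x /andP[_ xe].
rewrite -rnormN opprB ellp_rnormE; apply: (@le_lt_trans _ _ (e / 2)) => //.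
by rewrite ltr_pdivrMr// ltr_pMr// ltr1n.
Unshelve. all: by end_near. Qed.

HB.instance Definition _ := Uniform_isComplete.Build (ellp X p1) ellp_complete.

End EllpComplete.

(* A sequence (x_k) over k >= 1 is indexed from 0 here: x_k is x k.-1. *)
Definition backward (V : Type) (T : V -> V) (x : nat -> V) : nat -> V :=
  fun n => T (x n.+1).

Section BackwardEllp.
Context {R : realType} {k : scalar_kind} {X : normedModType (scalars R k)} {p : R}.
Variables (p1 : 1 <= p) (T : bounded_operator X).

Lemma lp_sum_backward M x : 0 <= M -> (forall u, rnorm (T u) <= M * rnorm u) ->
  (lp_sum p (backward T x) <= (M `^ p)%:E * lp_sum p x)%E.
Proof.
move=> M0 TM; have p0 : 0 <= p by exact: le_trans p1.
rewrite -nneseriesZl => [|n _]; last by rewrite lee_fin powR_ge0.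
rewrite [leRHS]nneseries_recl// => [|n _]; last by rewrite -EFinM lee_fin mulr_ge0 ?powR_ge0.
rewrite -[leLHS]add0e; apply: leeD; first by rewrite -EFinM lee_fin mulr_ge0 ?powR_ge0.
rewrite -nneseries_addn => [|n]; last by rewrite -EFinM lee_fin mulr_ge0 ?powR_ge0.
apply: lee_nneseries => [n _ _|n _]; first by rewrite lee_fin powR_ge0.
rewrite -EFinM lee_fin -powRM ?rnorm_ge0// addn1.
by apply: ge0_ler_powR; rewrite ?nnegrE ?mulr_ge0 ?rnorm_ge0 //; exact: TM.
Qed.

Lemma backward_lp_seq (x : ellp X p1) : backward T x \in lp_seq p1.
Proof.
have [M M0 TM] := bounded_operator_rnorm T.
apply/lp_seqP; apply: le_lt_trans (lp_sum_backward _ (ltW M0) TM) _.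
by rewrite -(fineK (lp_sum_fin (ellpP x))) -EFinM ltry.
Qed.

Definition ellp_backward_fun (x : ellp X p1) : ellp X p1 :=
  Ellp (backward_lp_seq x).

Lemma ellp_backward_fun_linear : linear ellp_backward_fun.
Proof. by move=> l x y; apply/val_inj/funext => n; exact: linearP. Qed.

HB.instance Definition _ := GRing.isLinear.Build (scalars R k) (ellp X p1)
  (ellp X p1) _ ellp_backward_fun ellp_backward_fun_linear.

Lemma ellp_backward_fun_bounded :
  bounded_near ellp_backward_fun (nbhs (0 : ellp X p1)).
Proof.
have [M M0 TM] := bounded_operator_rnorm T.
have p0 : 0 < p by exact: lt_le_trans p1.
apply: (rnorm_bounded_near (ltW M0)) => x; rewrite !ellp_rnormE.
have Mx0 : 0 <= M * lp_norm p x by apply: mulr_ge0 (ltW M0) (lp_norm_ge0 _ _).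
have : ((ellp_backward_fun x : nat -> X) \in lp_seq p1) &&
  (lp_norm p (ellp_backward_fun x) <= M * lp_norm p x); last by case/andP.
rewrite (lp_norm_leP p1 _ Mx0) (powRM _ (ltW M0) (lp_norm_ge0 _ _)) EFinM.
apply: le_trans (lp_sum_backward _ (ltW M0) TM) _.
rewrite lee_wpmul2l ?lee_fin ?powR_ge0//.
by rewrite -(lp_norm_leP p1) ?lp_norm_ge0// ellpP /=.
Qed.

Definition ellp_backward : bounded_operator (ellp X p1) :=
  BoundedOperator ellp_backward_fun_bounded.

End BackwardEllp.

Section BackwardC0.
Context {R : realType} {k : scalar_kind} {X : normedModType (scalars R k)}.
Variable T : bounded_operator X.

Lemma backward_c0_seq (x : c0 X) : backward T x \in c0_seq.
Proof.
have [M M0 TM] := bounded_operator_rnorm T.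
apply/c0_seqP.
have Mx : M * rnorm (x n.+1) @[n --> \oo] --> (0 : R).
  rewrite -(mulr0 M); apply: cvgMl_tmp; have /c0_seqP := c0P x.
  by rewrite -(cvg_shiftS (fun n => rnorm (x n))).
have TMx : \forall n \near \oo,
    cst 0 n <= rnorm (backward T x n) <= M * rnorm (x n.+1).
  by apply: nearW => n; rewrite rnorm_ge0 TM.
by apply: (squeeze_cvgr TMx) => //; exact: cvg_cst.
Qed.

Definition c0_backward_fun (x : c0 X) : c0 X := C0 (backward_c0_seq x).

Lemma c0_backward_fun_linear : linear c0_backward_fun.
Proof. by move=> l x y; apply/val_inj/funext => n; exact: linearP. Qed.

HB.instance Definition _ := GRing.isLinear.Build (scalars R k) (c0 X)
  (c0 X) _ c0_backward_fun c0_backward_fun_linear.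

Lemma c0_backward_fun_bounded :
  bounded_near c0_backward_fun (nbhs (0 : c0 X)).
Proof.
have [M M0 TM] := bounded_operator_rnorm T.
apply: (rnorm_bounded_near (ltW M0)) => x; rewrite !c0_rnormE.
apply: sup_norm_le => n; rewrite (le_trans (TM _))// (ler_wpM2l (ltW M0))//.
by rewrite le_rnorm_sup_norm ?c0P.
Qed.

Definition c0_backward : bounded_operator (c0 X) :=
  BoundedOperator c0_backward_fun_bounded.

End BackwardC0.

(* Main.v *)
Require Import Defs.
From HB Require Import structures.
From mathcomp Require Import all_boot all_order all_algebra.
From mathcomp Require Import all_classical all_reals all_analysis.

Set Implicit Arguments.
Unset Strict Implicit.
Unset Printing Implicit Defensive.

Import Order.TTheory GRing.Theory Num.Theory.
Import numFieldNormedType.Exports.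
Local Open Scope classical_set_scope.
Local Open Scope ring_scope.

(* Only small vectors need to be lifted, not all of X. If x has a dense
   T-orbit then, for arbitrarily large n, some arbitrarily small s (itself a
   point of the orbit) has T^n s close to x. Finite sequences v with entries
   v_i = T^(l_i) x are dense, and putting T^(l_i) s in coordinate n + i yields a
   small sequence which B_T^n maps close to v; adding it to a sequence supported
   in the first n coordinates, which B_T^n kills, shows that B_T is topologically
   transitive. A single s serves all coordinates, so no transitivity of the
   direct sums T + ... + T (which may fail) is required. Birkhoff's theorem
   concludes. *)

(** * Norm estimates and dense orbits of a bounded operator *)

Section Rnorm.
Context {R : realType} {k : scalar_kind} {X : normedModType (scalars R k)}.

Lemma rnorm_distC (x y : X) : rnorm (x - y) = rnorm (y - x).
Proof. by rewrite -rnormN opprB. Qed.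

Lemma rnorm_distD (z x y : X) : rnorm (x - y) <= rnorm (x - z) + rnorm (z - y).
Proof. by rewrite -(subrKA z x) rnormD. Qed.

Lemma rnorm_sum (n : nat) (f : nat -> X) :
  rnorm (\sum_(i < n) f i) <= \sum_(i < n) rnorm (f i).
Proof.
elim: n => [|n IHn]; first by rewrite !big_ord0 rnorm0.
by rewrite !big_ord_recr (le_trans (rnormD _ _))// lerD.
Qed.

Lemma dense_rnormP (A : set X) :
  dense A <-> forall (y : X) (e : R), 0 < e -> exists2 a, A a & rnorm (y - a) < e.
Proof.
split=> [dA y e e0|dA O [y Oy] oO].
  have [a []] : ball y (of_real k e) `&` A !=set0.
    apply: dA; last exact: ball_open.
    by exists y; apply: ballxx; exact: of_real_gt0.
  rewrite -ball_normE /ball_/= rnormE of_real_lt => ya Aa; by exists a.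
have /nbhs_ballP[e /= /real_part_gt0[e0 eE] yeO] : nbhs y O.
  by apply: open_nbhs_nbhs.
have [a Aa ya] := dA y _ e0; exists a; split=> //; apply: yeO.
by rewrite -ball_normE /ball_/= rnormE eE of_real_lt.
Qed.

Lemma iter_bounded_operatorB (T : bounded_operator X) n :
  {morph iter n T : x y / x - y}.
Proof. by elim: n => // n IHn x y; rewrite !iterS IHn linearB. Qed.

Lemma iter_bounded_operator_rnorm (T : bounded_operator X) n :
  exists2 C : R, 0 < C & forall x, rnorm (iter n T x) <= C * rnorm x.
Proof.
have [M M0 TM] := bounded_operator_rnorm T.
elim: n => [|n [C C0 TC]]; first by exists 1 => // x; rewrite mul1r.
exists (M * C) => [|x]; first exact: mulr_gt0.
by rewrite iterS (le_trans (TM _))// -mulrA ler_wpM2l// ltW.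
Qed.

Lemma iter_bounded_operator0 (T : bounded_operator X) n : iter n T 0 = 0.
Proof. by elim: n => // n IHn; rewrite iterS IHn linear0. Qed.

Lemma exists_rnorm_lt (x : X) (e : R) : x != 0 -> 0 < e ->
  exists2 z : X, z != 0 & rnorm z < e.
Proof.
move=> x0 e0; have nx0 : 0 < rnorm x.
  rewrite lt_neqAle rnorm_ge0 andbT eq_sym.
  by apply: contra_neq x0; exact: rnorm0_eq0.
pose c := e / 2 / rnorm x; have c0 : 0 < c by rewrite !divr_gt0.
exists (of_real k c *: x).
  by rewrite scaler_eq0 (negbTE x0) orbF gt_eqF// of_real_gt0.
rewrite rnormZ ger0_norm ?(ltW (of_real_gt0 c0))// of_realK.
by rewrite divfK ?gt_eqF// ltr_pdivrMr// ltr_pMr// ltr1n.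
Qed.

(* X has no isolated point, so a dense orbit stays dense after dropping
   finitely many terms. *)
Lemma dense_orbit_ge (T : X -> X) (x : X) : x != 0 ->
  dense (range (fun n => iter n T x)) ->
  forall (N : nat) (y : X) (e : R), 0 < e ->
    exists2 l, (N <= l)%N & rnorm (y - iter l T x) < e.
Proof.
move=> x0 /dense_rnormP dx; elim=> [|N IHN] y e e0.
  by have [_ [l _ <-] yl] := dx y e e0; exists l.
(* The induction drops one more orbit term, here the [N]-th. A target [y] equal to that term is
   moved by less than [e], so that the new target [y'] differs from it. *)
have [y' yy' y'N] : exists2 y', rnorm (y - y') < e & y' != iter N T x.
  have [yN|yN] := eqVneq y (iter N T x); last first.
    by exists y => //; rewrite subrr rnorm0.
  have [z z0 ze] := exists_rnorm_lt x0 e0; exists (y + z).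
    by rewrite opprD addNKr rnormN.
  by rewrite -yN -subr_eq0 addrAC subrr add0r.
have d0 : 0 < rnorm (y' - iter N T x).
  rewrite lt_neqAle rnorm_ge0 andbT eq_sym.
  by apply: contra_neq y'N => /rnorm0_eq0/eqP; rewrite subr_eq0 => /eqP.
(* The first bound keeps the approximant within [e] of [y]; the second puts it closer to [y'] than
   the [N]-th term, so its index is not [N]. *)
have m0 : 0 < Num.min (e - rnorm (y - y')) (rnorm (y' - iter N T x)).
  by rewrite lt_min subr_gt0 yy'.
have [l Nl] := IHN y' _ m0.
rewrite lt_min ltrBrDl => /andP[le lN]; exists l.
  by rewrite ltn_neqAle Nl andbT; apply: contraTneq lN => ->; rewrite ltxx.
by rewrite (le_lt_trans (rnorm_distD y' _ _)).
Qed.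

(** The orbit is near 0 at some time [j] and near [x] at some time [l >= N + j]; take [s] = T^j x
    and [n = l - j]. *)
Lemma small_preimage_of_orbit_point (T : bounded_operator X) (x : X) :
  dense (range (fun n => iter n T x)) ->
  forall (N : nat) (e : R), 0 < e -> exists n s,
    [/\ (N <= n)%N, rnorm s < e & rnorm (x - iter n T s) < e].
Proof.
move=> dx N e e0; have [->|x0] := eqVneq x 0.
  exists N, 0; split=> //; first by rewrite rnorm0.
  by rewrite iter_bounded_operator0 subrr rnorm0.
have [j _ sj] := dense_orbit_ge x0 dx 0 0 e0.
have [l Nl xl] := dense_orbit_ge x0 dx (N + j) x e0.
exists (l - j)%N, (iter j T x); split.
- by rewrite leq_subRL ?(leq_trans _ Nl) ?leq_addl// addnC.
- by rewrite -rnormN -sub0r.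
- by rewrite -iterD subnK// (leq_trans _ Nl)// leq_addl.
Qed.

End Rnorm.

(** * Baire's theorem and Birkhoff's transitivity theorem *)

Section Baire.
Context {R : realType} {k : scalar_kind} {Y : completeNormedModType (scalars R k)}.

(** By the third hypothesis each closed ball contains the next. Since the radii at least halve, the
    centres are Cauchy, and their limit lies in every ball. *)
Lemma nested_closed_balls (w : nat -> Y) (r : nat -> R) :
  (forall j, 0 < r j) -> (forall j, r j.+1 <= r j / 2) ->
  (forall j, rnorm (w j - w j.+1) + r j.+1 <= r j) ->
  exists z, forall j, rnorm (w j - z) <= r j.
Proof.
move=> r0 r2 wr.
have wm j m : rnorm (w j - w (j + m)%N) + r (j + m)%N <= r j.
  elim: m => [|m IHm]; first by rewrite addn0 subrr rnorm0 add0r.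
  apply: le_trans IHm; rewrite addnS.
  rewrite (le_trans (lerD (rnorm_distD (w (j + m)%N) _ _) (lexx _)))//.
  by rewrite -addrA lerD2l.
have wl j n : (j <= n)%N -> rnorm (w j - w n) <= r j.
  by move=> jn; have := wm j (n - j)%N; rewrite subnKC//;
    apply: le_trans; rewrite lerDl ltW.
have rgeo j : r j <= r 0%N * (2^-1) ^+ j.
  elim: j => [|j IHj]; first by rewrite expr0 mulr1.
  by rewrite exprSr mulrA (le_trans (r2 j))// ler_pM2r.
have rcvg : r @ \oo --> 0.
  have geo : r 0%N * (2^-1) ^+ j @[j --> \oo] --> 0.
    rewrite -(mulr0 (r 0%N)); apply: cvgMl_tmp; apply: cvg_expr.
    by rewrite ger0_norm// invf_lt1// ltr1n.
  have sq : \forall j \near \oo, cst 0 j <= r j <= r 0%N * (2^-1) ^+ j.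
    by apply: nearW => j; rewrite ltW//= rgeo.
  by apply: (squeeze_cvgr sq) => //; exact: cvg_cst.
have wcvg : cvg (w @ \oo).
  apply: cauchy_cvg; apply/cauchy_rnormP => e e0.
  have e20 : 0 < e / 2 by rewrite divr_gt0.
  have /cvgrPdist_lt/(_ _ e20)[N _ rN] := rcvg.
  have wN n : (N <= n)%N -> rnorm (w n - w N) < e / 2.
    move=> Nn; rewrite rnorm_distC (le_lt_trans (wl _ _ Nn))//.
    by have := rN N (leqnn N); rewrite /= sub0r normrN ger0_norm// ltW.
  rewrite near_map2; exists ([set n | (N <= n)%N], [set n | (N <= n)%N]).
    by split; exists N.
  move=> [a b] [/= Na Nb]; rewrite (le_lt_trans (rnorm_distD (w N) _ _))//.
  by rewrite (splitr e) ltrD ?wN// rnorm_distC wN.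
exists (lim (w @ \oo)) => j; apply/ler_addgt0Pr => e e0.
have /cvg_rnormP/(_ _ e0)[N _ wN] := wcvg.
rewrite (le_trans (rnorm_distD (w (maxn j N)) _ _))// lerD ?wl ?leq_maxl//.
by rewrite rnorm_distC ltW// wN//= leq_maxr.
Qed.

(* Baire's theorem: each F i contains a dense open set. The library version
   only covers real scalars. *)
Lemma baire_rnorm (F : nat -> set Y) :
  (forall i (y : Y) (e : R), 0 < e -> exists w (r : R),
    [/\ 0 < r, rnorm (y - w) < e & forall z, rnorm (w - z) <= r -> F i z]) ->
  exists z, forall i, F i z.
Proof.
move=> FP.
have step i (c : Y * {posnum R}) : exists c' : Y * {posnum R},
    [/\ c'.2%:num <= c.2%:num / 2, rnorm (c.1 - c'.1) + c'.2%:num <= c.2%:num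
      & forall z, rnorm (c'.1 - z) <= c'.2%:num -> F i z].
  (* Half of the old radius bounds the move of the centre, the other half the new radius; together
     they give nesting. *)
  have e20 : 0 < c.2%:num / 2 by [].
  have [w [r [r0 cw wF]]] := FP i c.1 _ e20.
  have m0 : 0 < Num.min r (c.2%:num / 2) by rewrite lt_min r0.
  exists (w, PosNum m0); split=> /=.
  - by rewrite ge_min lexx orbT.
  - by rewrite [leRHS]splitr lerD ?(ltW cw)// ge_min lexx orbT.
  - by move=> z; rewrite le_min => /andP[+ _]; exact: wF.
(* The starting ball, of radius 1 around 0, is arbitrary; ball [i.+1] takes care of [F i]. *)
pose c := fix c j : Y * {posnum R} :=
  if j is i.+1 then sval (cid (step i (c i))) else (0, PosNum ltr01).
have cP i : [/\ (c i.+1).2%:num <= (c i).2%:num / 2,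
    rnorm ((c i).1 - (c i.+1).1) + (c i.+1).2%:num <= (c i).2%:num
    & forall z, rnorm ((c i.+1).1 - z) <= (c i.+1).2%:num -> F i z].
  exact: svalP (cid (step i (c i))).
have [|||z zP] := @nested_closed_balls (fun j => (c j).1) (fun j => (c j).2%:num).
- by [].
- by move=> j; have [] := cP j.
- by move=> j; have [] := cP j.
by exists z => i; have [_ _] := cP i; apply.
Qed.

(* Birkhoff's transitivity theorem. *)
Lemma transitive_hypercyclic (I : countType) (d : I -> Y) (S : bounded_operator Y) :
  dense (range d) ->
  (forall y i (e : R), 0 < e -> exists w n,
    rnorm (y - w) < e /\ rnorm (d i - iter n S w) < e) ->
  hypercyclic S.
Proof.
move=> /dense_rnormP dd trS.
(* [G (i, m)] collects the points whose orbit comes within 1/(m+1) of [d i]. [F] lists these sets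
   along their codes, with the whole space at numbers that code nothing. *)
pose G (c : I * nat) := [set z | exists n, rnorm (d c.1 - iter n S z) < c.2.+1%:R^-1].
pose F i := if unpickle i is Some c then G c else setT.
have [|z zF] := @baire_rnorm F; last first.
  exists z; apply/dense_rnormP => y e e0.
  have e20 : 0 < e / 2 by rewrite divr_gt0.
  have [_ [i _ <-] yi] := dd y _ e20.
  have [m _ /(_ m (leqnn m)) me] := near_infty_natSinv_lt (PosNum e20).
  have := zF (pickle (i, m)); rewrite /F pickleK => -[n /= zn].
  exists (iter n S z); [by exists n|rewrite (splitr e)].
  by rewrite (le_lt_trans (rnorm_distD (d i) _ _))// ltrD// (lt_trans zn).
move=> i y e e0; rewrite /F; case: unpickle => [[j m]|]; last first.
  by exists y, 1; rewrite subrr rnorm0.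
have me0 : 0 < Num.min e m.+1%:R^-1 by rewrite lt_min e0 invr_gt0 ltr0Sn.
have [w [n []]] := trS y j _ me0; rewrite !lt_min => /andP[yw _] /andP[_ wn].
have [C C0 SC] := iter_bounded_operator_rnorm S n.
have g0 : 0 < m.+1%:R^-1 - rnorm (d j - iter n S w) by rewrite subr_gt0.
(* On this ball S^n moves points by at most half of the slack left around [d j], since [C] is a
   Lipschitz constant of S^n. *)
exists w, ((m.+1%:R^-1 - rnorm (d j - iter n S w)) / 2 / C); split=> //.
  by rewrite !divr_gt0.
move=> z; rewrite ler_pdivlMr// mulrC => wz; exists n => /=.
rewrite (le_lt_trans (rnorm_distD (iter n S w) _ _))// -ltrBrDl.
rewrite -iter_bounded_operatorB (le_lt_trans (SC _))// (le_lt_trans wz)//.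
by rewrite ltr_pdivrMr// ltr_pMr// ltr1n.
Qed.

End Baire.

(** * Hypercyclicity of an abstract backward shift *)

Section CoordinateShift.
Context {R : realType} {k : scalar_kind}.
Context {X Y : completeNormedModType (scalars R k)}.
(** [e i] stands for the inclusion of [X] as coordinate [i], and [S] for B_T. The hypotheses hold in
    c_0 and in l^p alike, so one argument serves both. *)
Variables (T : bounded_operator X) (S : bounded_operator Y) (e : nat -> X -> Y).
Hypothesis eB : forall i, {morph e i : a b / a - b}.
Hypothesis e_rnorm : forall i a, rnorm (e i a) <= rnorm a.
Hypothesis e_dense : forall (y : Y) (d : R), 0 < d ->
  exists n (f : nat -> X), rnorm (y - \sum_(i < n) e i (f i)) < d.
Hypothesis Se0 : forall a, S (e 0%N a) = 0.
Hypothesis SeS : forall i a, S (e i.+1 a) = e i (T a).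

Let iter_Se n i a : iter n S (e (n + i)%N a) = e i (iter n T a).
Proof. by elim: n i a => // n IHn i a; rewrite iterSr SeS IHn -iterSr. Qed.

(** After [i] steps the vector sits in coordinate 0, and the next step kills it. *)
Let iter_Se_lt n i a : (i < n)%N -> iter n S (e i a) = 0.
Proof.
move=> ilt; rewrite -(subnK ilt) iterD iterS -[X in e X _]addn0 iter_Se Se0.
exact: iter_bounded_operator0.
Qed.

Let iter_S_sum n m (f : nat -> Y) :
  iter n S (\sum_(i < m) f i) = \sum_(i < m) iter n S (f i).
Proof.
elim: n => // n IHn; rewrite iterS IHn linear_sum.
by apply: eq_bigr => i _; rewrite iterS.
Qed.

(** This crude l^1 bound suffices in either norm: the number of terms is always fixed before the
    accuracy. *)
Let dist_sum_e n (f g : nat -> X) (j : nat -> nat) :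
  rnorm (\sum_(i < n) e (j i) (f i) - \sum_(i < n) e (j i) (g i)) <=
  \sum_(i < n) rnorm (f i - g i).
Proof.
rewrite -sumrB (le_trans (rnorm_sum _ (fun i => e (j i) (f i) - e (j i) (g i))))//.
by apply: ler_sum => i _; rewrite -eB.
Qed.

Lemma coordinate_shift_hypercyclic : hypercyclic T -> hypercyclic S.
Proof.
move=> [x dx].
(* A list [l] codes the finite sequence with entries T^(l_i) x, which gives Birkhoff's theorem a
   countable index type. *)
pose d (l : seq nat) := \sum_(i < size l) e i (iter (nth 0%N l i) T x).
apply: (@transitive_hypercyclic R k Y (seq nat) d).
  apply/dense_rnormP => y r r0; have r20 : 0 < r / 2 by rewrite divr_gt0.
  have [n [f yf]] := e_dense y r20.
  (* Using [n.+1] avoids a division by zero when [n = 0]; the [n] errors still add up to at most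
     r/2. *)
  have rn0 : 0 < r / 2 / n.+1%:R by rewrite divr_gt0.
  have /choice[l fl] : forall i, exists m, rnorm (f i - iter m T x) < r / 2 / n.+1%:R.
    move=> i; have [_ [m _ <-] fm] := (dense_rnormP _).1 dx (f i) _ rn0.
    by exists m.
  exists (d (mkseq l n)); first by exists (mkseq l n).
  rewrite (le_lt_trans (rnorm_distD (\sum_(i < n) e i (f i)) _ _))//.
  rewrite (splitr r) ltr_leD// /d size_mkseq.
  under [X in _ - X]eq_bigr => i _ do rewrite nth_mkseq//.
  rewrite (le_trans (dist_sum_e n f (fun i => iter (l i) T x) id))//.
  rewrite (@le_trans _ _ (\sum_(i < n) r / 2 / n.+1%:R))//.
    by apply: ler_sum => i _; exact: ltW.
  rewrite sumr_const card_ord -[leLHS]mulr_natr mulrAC ler_pdivrMr//.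
  by rewrite ler_wpM2l ?(ltW r20)// ler_nat.
move=> y l r r0; have r20 : 0 < r / 2 by rewrite divr_gt0.
have [n [f yf]] := e_dense y r20.
have /choice[C CP] : forall i, exists C : R, 0 < C /\
    forall x, rnorm (iter (nth 0%N l i) T x) <= C * rnorm x.
  by move=> i; have [C C0 TC] := iter_bounded_operator_rnorm T (nth 0%N l i); exists C.
(* [D] dominates the sum of the Lipschitz constants of the T^(l_i); the 1 keeps it positive for
   empty [l]. *)
pose D := 1 + \sum_(i < size l) C i.
have D0 : 0 < D by rewrite ltr_pwDl// sumr_ge0// => i _; have [/ltW] := CP i.
have sumD z : \sum_(i < size l) rnorm (iter (nth 0%N l i) T z) <= D * rnorm z.
  rewrite /D mulrDl mulr_suml ler_wpDl ?mulr_ge0 ?rnorm_ge0//.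
  by apply: ler_sum => i _; have [_] := CP i; exact.
have rD0 : 0 < r / 2 / D by rewrite divr_gt0.
have [N [s [nN sr xs]]] := small_preimage_of_orbit_point dx n rD0.
(* [u] is close to [y] and is killed by S^N because [n <= N]; [v] is small because [s] is, and S^N
   brings it back to the first [size l] coordinates. *)
pose u := \sum_(i < n) e i (f i).
pose v := \sum_(i < size l) e (N + i)%N (iter (nth 0%N l i) T s).
exists (u + v), N; split.
  have -> : y - (u + v) = (y - u) - v by rewrite opprD addrA.
  rewrite (le_lt_trans (rnormD _ _))// rnormN (splitr r) ltrD//.
  rewrite (@le_lt_trans _ _ (D * rnorm s))//; last first.
    by rewrite mulrC -ltr_pdivlMr.
  apply: le_trans (sumD s).
  rewrite (le_trans (rnorm_sum _ (fun i => e (N + i)%N (iter (nth 0%N l i) T s))))//.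
  by apply: ler_sum => i _.
have -> : iter N S (u + v) = \sum_(i < size l) e i (iter (nth 0%N l i) T (iter N T s)).
  have -> : iter N S (u + v) = iter N S u + iter N S v.
    rewrite -[v in LHS]opprK iter_bounded_operatorB -[- v]sub0r.
    by rewrite iter_bounded_operatorB iter_bounded_operator0 sub0r opprK.
  rewrite /u /v (iter_S_sum _ _ (fun i => e i (f i))).
  rewrite (iter_S_sum _ _ (fun i => e (N + i)%N (iter (nth 0%N l i) T s))).
  rewrite big1 ?add0r => [|i _].
    by apply: eq_bigr => i _; rewrite iter_Se -!iterD addnC.
  by rewrite iter_Se_lt// (leq_trans _ nN).
(* Powers of [T] commute, so entry [i] is off by T^(l_i) (x - T^N s), and [D] controls the total. *)
rewrite (le_lt_trans (dist_sum_e _ (fun i => iter (nth 0%N l i) T x)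
  (fun i => iter (nth 0%N l i) T (iter N T s)) id))//.
under eq_bigr do rewrite -iter_bounded_operatorB.
rewrite (le_lt_trans (sumD _))// (@lt_trans _ _ (r / 2))//.
  by rewrite mulrC -ltr_pdivlMr.
by rewrite ltr_pdivrMr// ltr_pMr// ltr1n.
Qed.

End CoordinateShift.

(** * Finitely supported sequences in c_0 and l^p *)

Section Single.
Context {R : realType} {k : scalar_kind} {X : completeNormedModType (scalars R k)}.

Definition single (i : nat) (a : X) : nat -> X := fun n => if n == i then a else 0.

Lemma singleB i : {morph single i : a b / a - b}.
Proof.
move=> a b; apply/funext => n.
rewrite -[RHS]/(single i a n - single i b n) /single.
by case: ifP => // _; rewrite subr0.
Qed.

Lemma sum_single n (f : nat -> X) m :
  \sum_(i < n) single i (f i) m = if (m < n)%N then f m else 0.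
Proof.
rewrite /single; under eq_bigr do rewrite eq_sym.
rewrite -big_mkcond/=; case: ifPn => mn.
  by rewrite (big_pred1 (Ordinal mn)).
rewrite big1// => i /eqP im; case/negP: mn; by rewrite -im.
Qed.

Lemma backward_single0 (T : bounded_operator X) a : backward T (single 0%N a) = 0.
Proof. by apply/funext => n; rewrite /backward/= linear0. Qed.

Lemma backward_singleS (T : bounded_operator X) i a :
  backward T (single i.+1 a) = single i (T a).
Proof.
apply/funext => n; rewrite /backward /single eqSS.
by case: ifP => // _; rewrite linear0.
Qed.

Lemma single_c0 i a : single i a \in c0_seq.
Proof.
apply/c0_seqP; apply: cvg_near_cst.
exists i.+1 => // n /= ni; rewrite /single gtn_eqF//; exact: rnorm0.
Qed.

Lemma sup_norm_single i a : sup_norm (single i a) <= rnorm a.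
Proof.
apply: sup_norm_le => n; rewrite /single; case: ifP => // _.
by rewrite rnorm0 rnorm_ge0.
Qed.

(** [y] is cut after an index beyond which its entries are smaller than d/2; the half leaves room
    for the non-strict bound on the supremum. *)
Lemma c0_single_dense (y : c0 X) (d : R) : 0 < d ->
  exists n (f : nat -> X), rnorm (y - \sum_(i < n) C0 (single_c0 i (f i))) < d.
Proof.
move=> d0; have d20 : 0 < d / 2 by rewrite divr_gt0.
have /c0_seqP/cvgrPdist_lt/(_ _ d20)[n _ yn] := c0P y.
exists n, y; rewrite c0_rnormE (@le_lt_trans _ _ (d / 2))//; last first.
  by rewrite ltr_pdivrMr// ltr_pMr// ltr1n.
apply: sup_norm_le => m.
(* Taking a coordinate is additive, hence passes through the finite sum. *)
have -> : c0_val (y - \sum_(i < n) C0 (single_c0 i (y i))) m =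
    y m - \sum_(i < n) single i (y i) m.
  by congr (_ - _); elim/big_ind2 : _ => //= x1 z1 x2 z2 <- <-.
rewrite sum_single; case: ltnP => mn; first by rewrite subrr rnorm0 ltW.
have := yn m mn; rewrite subr0 sub0r normrN ger0_norm ?rnorm_ge0//.
exact: ltW.
Qed.

Lemma c0_backward_hypercyclic (T : bounded_operator X) :
  hypercyclic T -> hypercyclic (c0_backward T).
Proof.
apply: (coordinate_shift_hypercyclic (e := fun i a => C0 (single_c0 i a))).
- by move=> i a b; apply/val_inj; exact: singleB.
- by move=> i a; rewrite c0_rnormE; exact: sup_norm_single.
- exact: c0_single_dense.
- by move=> a; apply/val_inj; exact: backward_single0.
- by move=> i a; apply/val_inj; exact: backward_singleS.
Qed.

Context {p : R}.
Variable p1 : 1 <= p.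

Let p0 : 0 < p. Proof. exact: lt_le_trans p1. Qed.

(** Membership is proved along with the bound because [lp_norm] reads an infinite sum as 0, so that
    a bound alone would not give it. *)
Lemma single_lp_norm i a :
  (single i a \in lp_seq p1) && (lp_norm p (single i a) <= rnorm a).
Proof.
rewrite lp_norm_leP ?rnorm_ge0//; apply: lp_sum_le => n.
rewrite sumEFin lee_fin.
rewrite (eq_bigr (fun j => if j == i then rnorm a `^ p else 0)); last first.
  by move=> j _; rewrite /single; case: ifP => // _; rewrite rnorm0 powR0 ?gt_eqF.
rewrite -big_mkcond/= big_nat1_eq.
by case: ifP => // _; exact: powR_ge0.
Qed.

Lemma single_lp i a : single i a \in lp_seq p1.
Proof. by have /andP[] := single_lp_norm i a. Qed.

(** Truncation again: the p-th power of the error is a tail of the convergent series of p-th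
    powers. *)
Lemma ellp_single_dense (y : ellp X p1) (d : R) : 0 < d ->
  exists n (f : nat -> X), rnorm (y - \sum_(i < n) Ellp (single_lp i (f i))) < d.
Proof.
move=> d0; have d20 : 0 < d / 2 by rewrite divr_gt0.
pose f n := (rnorm (y n) `^ p)%:E.
have f0 n : (0 <= f n)%E by rewrite lee_fin powR_ge0.
have tail0 : (\sum_(N <= n <oo) f n)%E @[N --> \oo] --> 0%E.
  by apply: nneseries_tail_cvg => //; exact/lp_seqP/(ellpP y).
have c0 : (0 < ((d / 2) `^ p)%:E)%E by rewrite lte_fin powR_gt0.
have [N _ /(_ N (leqnn N)) /= yN] := tail0 _ (open_ereal_lt' c0).
exists N, y; rewrite ellp_rnormE (@le_lt_trans _ _ (d / 2))//; last first.
  by rewrite ltr_pdivrMr// ltr_pMr// ltr1n.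
set z := y - _.
suff /andP[_] : (ellp_seq z \in lp_seq p1) && (lp_norm p z <= d / 2) by [].
rewrite (lp_norm_leP p1 _ (ltW d20)); apply: le_trans (ltW yN).
(* The tail from [N] becomes a series from 0 with zero terms below [N], to be compared term by term
   with that of [z]. *)
rewrite eseries_cond eseries_mkcond; apply: lee_nneseries => n _ /=.
  by rewrite lee_fin powR_ge0.
rewrite [X in rnorm X](_ : _ = y n - \sum_(i < N) single i (y i) n); last first.
  by congr (_ - _); elim/big_ind2 : _ => //= x1 z1 x2 z2 <- <-.
rewrite sum_single; case: ltnP => nN; last by rewrite subr0.
by rewrite subrr rnorm0 powR0// gt_eqF.
Qed.

Lemma ellp_backward_hypercyclic (T : bounded_operator X) :
  hypercyclic T -> hypercyclic (ellp_backward p1 T).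
Proof.
apply: (coordinate_shift_hypercyclic (e := fun i a => Ellp (single_lp i a))).
- by move=> i a b; apply/val_inj; exact: singleB.
- by move=> i a; rewrite ellp_rnormE; have /andP[] := single_lp_norm i a.
- exact: ellp_single_dense.
- by move=> a; apply/val_inj; exact: backward_single0.
- by move=> i a; apply/val_inj; exact: backward_singleS.
Qed.

End Single.

Theorem proposition2p4 (R : realType) (k : scalar_kind)
    (X : completeNormedModType (scalars R k)) (T : bounded_operator X) :
  hypercyclic T ->
  (forall (p : R) (p1 : 1 <= p), hypercyclic (ellp_backward p1 T)) /\
  hypercyclic (c0_backward T).
Proof.
move=> hT; split=> [p p1|]; first exact: ellp_backward_hypercyclic.
exact: c0_backward_hypercyclic.
Qed.
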